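(* Let $k\in\mathbb{Z}$, $\lambda,\mu\in\mathbb{C}$ and $s\in\mathbb{Z}_{\ge 0}$. For every integer $n\ge 0$, as polynomials in $x$, $$CP_{n}^{(k)}(x;\lambda,\mu)=\sum_{m=0}^{n}(-1)^{m}\left\{\sum_{l=0}^{n-m}\sum_{i=0}^{l}\binom{n}{l}\binom{l}{i}S_{1}(n-l,m)\,\mathbb{C}_{i}^{(s)}\,CP_{l-i}^{(k)}(s;\lambda,\mu)\right\}B_{m}^{(s)}(x).$$
   Context: All generating functions are formal power series in $t$ over $\mathbb{C}$. For $k\in\mathbb{Z}$, $\mathrm{Lif}_k(t)=\sum_{n=0}^{\infty}\frac{t^{n}}{n!(n+1)^{k}}$. For $\lambda,\mu\in\mathbb{C}$, $(1+t)^{\lambda}=\sum_{j\ge0}\binom{\lambda}{j}t^j$ and $(1+(1+t)^{\lambda})^{-\mu}=2^{-\mu}\bigl(1+\frac12\sum_{j\ge 1}\binom{\lambda}{j}t^{j}\bigr)^{-\mu}$ (binomial series, $2^{-\mu}=e^{-\mu\log 2}$). The poly-Cauchy of the first kind and Peters mixed-type polynomials $CP_n^{(k)}(x;\lambda,\mu)$ are defined by $$(1+(1+t)^{\lambda})^{-\mu}\,\mathrm{Lif}_k(\log(1+t))\,(1+t)^{-x}=\sum_{n=0}^{\infty}CP_n^{(k)}(x;\lambda,\mu)\frac{t^n}{n!}.$$ The Stirling numbers of the first kind $S_1(n,l)$ are defined by $x(x-1)\cdots(x-n+1)=\sum_{l=0}^{n}S_1(n,l)x^{l}$, with $S_1(n,l)=0$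 for $l>n$. For $s\in\mathbb{Z}_{\ge0}$, the Bernoulli polynomials of order $s$ are defined by $\left(\frac{t}{e^{t}-1}\right)^{s}e^{xt}=\sum_{n\ge0}B_n^{(s)}(x)\frac{t^n}{n!}$. The higher-order Cauchy polynomials of the first kind are defined by $\left(\frac{t}{\log(1+t)}\right)^{s}(1+t)^{-x}=\sum_{n\ge0}\mathbb{C}_n^{(s)}(x)\frac{t^n}{n!}$, and $\mathbb{C}_i^{(s)}=\mathbb{C}_i^{(s)}(0)$. *)

(* Defs.v *)
From HB Require Import structures.
From mathcomp Require Import all_boot all_order all_algebra.
From mathcomp Require Import complex.
From mathcomp Require Import reals sequences exp trigo.

Set Implicit Arguments.
Unset Strict Implicit.
Unset Printing Implicit Defensive.

Import Order.TTheory GRing.Theory Num.Theory.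
Local Open Scope ring_scope.
Local Open Scope complex_scope.

(* A formal power series in t is its coefficient sequence.  The coefficient
   ring A is instantiated below by {poly R[i]}, whose variable 'X is x; there
   the nonzero natural numbers are units, so that (n%:R)^-1 is a genuine
   inverse. *)
Definition fps (A : Type) := nat -> A.

Section FormalPowerSeries.
Variable A : comUnitRingType.
Implicit Types (f g : fps A) (a : A).

Definition fps_one : fps A := fun n => (n == 0)%:R.

Definition fps_scale a f : fps A := fun n => a * f n.

Definition fps_mul f g : fps A := fun n => \sum_(i < n.+1) f i * g (n - i)%N.

Definition fps_exp f m : fps A := iter m (fps_mul f) fps_one.

(* f(g(t)), meaningful when g 0 = 0: then the terms f j * g^j with j > n do not
   contribute to t^n. *)
Definition fps_comp f g : fps A :=
  fun n => \sum_(j < n.+1) f j * fps_exp g j n.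

(* 1/f = \sum_j (1 - f)^j, for f 0 = 1; see fps_mul_inv. *)
Definition fps_inv f : fps A :=
  fps_comp (fun _ => 1) (fun n => fps_one n - f n).

(* t/f(t), for f 0 = 0 and f 1 = 1; see fps_mul_tdiv. *)
Definition fps_tdiv f : fps A := fps_inv (fun n => f n.+1).

(* a_n in \sum_n a_n t^n/n! *)
Definition egf_coef f n : A := n`!%:R * f n.

Definition gbinom a j : A := (\prod_(i < j) (a - i%:R)) / j`!%:R.

(* (1+t)^a *)
Definition fps_binom a : fps A := gbinom a.

(* e^(a t) *)
Definition fps_expt a : fps A := fun n => a ^+ n / n`!%:R.

(* e^t - 1 *)
Definition fps_expm1 : fps A := fun n => if n is 0 then 0 else (n`!%:R)^-1.

(* log(1+t) *)
Definition fps_log1p : fps A :=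
  fun n => if n is m.+1 then (-1) ^+ m / m.+1%:R else 0.

Definition Lif (k : int) : fps A := fun n => (n`!%:R * n.+1%:R ^ k)^-1.

(* (1/2) \sum_(j >= 1) binom(a, j) t^j = ((1+t)^a - 1)/2 *)
Definition half_binom a : fps A :=
  fun n => if n is 0 then 0 else 2%:R^-1 * gbinom a n.

Lemma fps_exp_small g j n : g 0 = 0 -> (n < j)%N -> fps_exp g j n = 0.
Proof.
move=> g0; elim: j n => [//|j IH] n; rewrite ltnS => lenj.
rewrite /fps_exp iterS /fps_mul; apply: big1 => -[[|i] /= lt_in] _.
  by rewrite g0 mul0r.
rewrite -/(fps_exp g j) IH ?mulr0 //.
by apply: leq_trans lenj; case: (n) lt_in => // p _; rewrite subSS ltnS leq_subr.
Qed.

Lemma fps_one_mul f n : fps_mul fps_one f n = f n.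
Proof.
rewrite /fps_mul big_ord_recl /fps_one /= mul1r subn0 big1 ?addr0 // => i _.
by rewrite mul0r.
Qed.

Lemma fps_mul_inv f n : f 0 = 1 -> fps_mul f (fps_inv f) n = fps_one n.
Proof.
move=> f0; set g : fps A := fun m => fps_one m - f m.
have g0 : g 0 = 0 by rewrite /g f0 subrr.
have invE m : (m <= n)%N -> fps_inv f m = \sum_(j < n.+1) fps_exp g j m.
  move=> lemn; rewrite /fps_inv /fps_comp -/g.
  rewrite (eq_bigr (fun j : 'I__ => fps_exp g j m)); last by move=> j _; rewrite mul1r.
  rewrite (big_ord_widen n.+1 (fun j => fps_exp g j m)) // big_mkcond /=.
  apply: eq_bigr => j _; case: ltnP => // ltmj.
  by rewrite fps_exp_small.
have step j : fps_mul f (fps_exp g j) n = fps_exp g j n - fps_exp g j.+1 n.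
  rewrite {3}/fps_exp iterS -/(fps_exp g j) -[X in _ = X - _]fps_one_mul.
  rewrite /fps_mul -sumrB; apply: eq_bigr => i _.
  by rewrite -mulrBl /g opprB addrC subrK.
transitivity (\sum_(j < n.+1) fps_mul f (fps_exp g j) n).
  rewrite [in RHS]/fps_mul exchange_big /=; apply: eq_bigr => i _.
  by rewrite invE ?leq_subr // mulr_sumr.
rewrite (eq_bigr (fun j : 'I__ => fps_exp g j n - fps_exp g j.+1 n)); last first.
  by move=> j _; rewrite step.
rewrite -(big_mkord xpredT (fun j => fps_exp g j n - fps_exp g j.+1 n)).
under eq_bigr do rewrite -opprB.
by rewrite sumrN telescope_sumr // opprB (@fps_exp_small g n.+1) // subr0.
Qed.

Lemma fps_mul_tdiv f n :
  f 0 = 0 -> f 1 = 1 -> fps_mul f (fps_tdiv f) n = (n == 1)%:R.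
Proof.
move=> f0 f1; rewrite /fps_mul big_ord_recl f0 mul0r add0r.
case: n => [|n]; first by rewrite big_ord0.
by rewrite -[RHS]/(fps_one n) -(@fps_mul_inv (fun m => f m.+1)).
Qed.

End FormalPowerSeries.

Section Polynomials.
Variable R : realType.
Local Notation C := R[i].
Local Notation P := {poly C}.

Definition cexp (z : C) : C :=
  (expR (complex.Re z))%:C * (cos (complex.Im z) +i* sin (complex.Im z)).

(* 2^z *)
Definition two_pow (z : C) : C := cexp (z * (ln 2)%:C).

(* (1 + (1+t)^lambda)^(-mu) *)
Definition peters_factor (lambda mu : C) : fps P :=
  fps_scale (two_pow (- mu))%:P
    (fps_comp (fps_binom (- mu)%:P) (half_binom lambda%:P)).

(* Poly-Cauchy of the first kind and Peters mixed-type polynomials; the value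
   at a complex number x is (CP k lambda mu n).[x]. *)
Definition CP (k : int) (lambda mu : C) (n : nat) : P :=
  egf_coef
    (fps_mul
      (fps_mul (peters_factor lambda mu) (fps_comp (Lif P k) (fps_log1p P)))
      (fps_binom (- 'X))) n.

Definition stirling1 (n l : nat) : int :=
  (\prod_(i < n) ('X - (i%:R)%:P) : {poly int})`_l.

Definition bernoulli_poly (s n : nat) : P :=
  egf_coef
    (fps_mul (fps_exp (fps_tdiv (fps_expm1 P)) s) (fps_expt 'X)) n.

(* Cauchy polynomials of the first kind of order s *)
Definition cauchy_poly (s n : nat) : P :=
  egf_coef
    (fps_mul (fps_exp (fps_tdiv (fps_log1p P)) s) (fps_binom (- 'X))) n.

Definition cauchy_num (s n : nat) : C := (cauchy_poly s n).[0].

End Polynomials.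

(* Main.v *)
(* Write L = log(1+t) and let G(t) (1+t)^(-x) be the generating function of the
   CP_n.  Substituting t -> -L in (t/(e^t-1))^s e^(xt) gives
     \sum_m (-1)^m B_m^(s)(x) L^m/m! = (L/t)^s (1+t)^(s-x),
   because e^(-L) - 1 = -t/(1+t).  Multiplying by (t/L)^s G(t) (1+t)^(-s), the
   product of the generating functions of the Cauchy numbers and of the
   CP_n(s), recovers G(t) (1+t)^(-x); the double inner sum of the theorem is the
   coefficient of t^n in this product, as L^m/m! = \sum_n S_1(n,m) t^n/n!. *)

From HB Require Import structures.
From mathcomp Require Import all_boot all_order all_algebra.
From mathcomp Require Import complex boolp reals ring zify.
Require Import Defs.

Set Implicit Arguments.
Unset Strict Implicit.
Unset Printing Implicit Defensive.

Import GRing.Theory Num.Theory.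
Local Open Scope ring_scope.

(** * The commutative ring of formal power series *)

Definition fps_trunc (A : comUnitRingType) (N : nat) (f : fps A) : {poly A} :=
  \poly_(i < N) f i.

(* The ring axioms and the multiplicativity of composition are transported from
   {poly A} through polynomials that agree with the series up to a given degree. *)
Section Agree.
Variable A : comUnitRingType.
Implicit Types (f g h : fps A) (p q : {poly A}).

Definition agree n p f := forall i, (i <= n)%N -> p`_i = f i.

Lemma agree_trunc n f : agree n (fps_trunc n.+1 f) f.
Proof. by move=> i lein; rewrite coef_poly ltnS lein. Qed.

Lemma agreeM n p q f g :
  agree n p f -> agree n q g -> agree n (p * q) (fps_mul f g).
Proof.
move=> pf qg i lein; rewrite coefM; apply: eq_bigr => j _.
have leji : (j <= i)%N by rewrite -ltnS.
by rewrite pf ?qg ?(leq_trans _ lein) // leq_subr.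
Qed.

Lemma agree1 n : agree n 1 (fps_one A).
Proof. by move=> i _; rewrite coef1. Qed.

Lemma agreeX n p f m : agree n p f -> agree n (p ^+ m) (fps_exp f m).
Proof.
move=> pf; elim: m => [|m IH]; first by rewrite expr0; apply: agree1.
by rewrite exprS; apply: agreeM.
Qed.

Lemma fps_mulA : associative (@fps_mul A).
Proof.
move=> f g h; apply/funext => n.
have [[af ag] ah] :=
  (agree_trunc (n := n) f, agree_trunc (n := n) g, agree_trunc (n := n) h).
rewrite -(agreeM af (agreeM ag ah) (leqnn n)).
by rewrite -(agreeM (agreeM af ag) ah (leqnn n)) mulrA.
Qed.

Lemma fps_mulC : commutative (@fps_mul A).
Proof.
move=> f g; apply/funext => n.
have [af ag] := (agree_trunc (n := n) f, agree_trunc (n := n) g).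
by rewrite -(agreeM af ag (leqnn n)) -(agreeM ag af (leqnn n)) mulrC.
Qed.

Lemma fps_mul1 : left_id (fps_one A) (@fps_mul A).
Proof. by move=> f; apply/funext => n; rewrite fps_one_mul. Qed.

Definition fps_zero : fps A := fun=> 0.
Definition fps_opp f : fps A := fun n => - f n.
Definition fps_add f g : fps A := fun n => f n + g n.

Lemma fps_addA : associative fps_add.
Proof. by move=> f g h; apply/funext => n; rewrite /fps_add addrA. Qed.
Lemma fps_addC : commutative fps_add.
Proof. by move=> f g; apply/funext => n; rewrite /fps_add addrC. Qed.
Lemma fps_add0 : left_id fps_zero fps_add.
Proof. by move=> f; apply/funext => n; rewrite /fps_add add0r. Qed.
Lemma fps_addN : left_inverse fps_zero fps_opp fps_add.
Proof. by move=> f; apply/funext => n; rewrite /fps_add addNr. Qed.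

Lemma fps_mulDl : left_distributive (@fps_mul A) fps_add.
Proof.
move=> f g h; apply/funext => n; rewrite /fps_add /fps_mul -big_split /=.
by apply: eq_bigr => i _; rewrite mulrDl.
Qed.

End Agree.

(** Equality and choice on coefficient sequences are classical; the ring hierarchy asks for both. *)
HB.instance Definition _ (A : comUnitRingType) := gen_eqMixin (fps A).
HB.instance Definition _ (A : comUnitRingType) := gen_choiceMixin (fps A).
HB.instance Definition _ (A : comUnitRingType) :=
  GRing.isZmodule.Build (fps A)
    (@fps_addA A) (@fps_addC A) (@fps_add0 A) (@fps_addN A).

Lemma fps_one_neq0 (A : comUnitRingType) : fps_one A != 0.
Proof.
apply/eqP => /(congr1 (fun f : fps A => f 0)) /eqP.
by rewrite /fps_one eqxx oner_eq0.
Qed.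

HB.instance Definition _ (A : comUnitRingType) :=
  GRing.Zmodule_isComNzRing.Build (fps A)
    (@fps_mulA A) (@fps_mulC A) (@fps_mul1 A) (@fps_mulDl A) (@fps_one_neq0 A).

(** * Powers, substitution and cancellation of t *)

Section Series.
Variable A : comUnitRingType.
Implicit Types (f g h : fps A) (p q : {poly A}).

Lemma fps_expE f m : fps_exp f m = f ^+ m.
Proof. by elim: m => [//|m IH]; rewrite exprS -IH. Qed.

Definition fps_var : fps A := fun n => (n == 1)%:R.

Lemma fps_var_mul f n : (fps_var * f) n = if n is m.+1 then f m else 0.
Proof.
rewrite -[fps_var * f]/(fps_mul fps_var f) /fps_mul big_ord_recl mul0r add0r.
case: n => [|n]; first by rewrite big_ord0.
by rewrite big_ord_recl mul1r subSS subn0 big1 ?addr0 // => i _; rewrite mul0r.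
Qed.

Lemma fps_var_inj : injective (GRing.mul fps_var).
Proof.
move=> f g eqfg; apply/funext => n.
by have := congr1 (fun h : fps A => h n.+1) eqfg; rewrite !fps_var_mul.
Qed.

(** The powers g^j with j > n contribute nothing to t^n, so any larger bound will do. This gives
    sums for different n a common range. *)
Lemma fps_comp_widen f g n N : g 0 = 0 -> (n < N)%N ->
  fps_comp f g n = \sum_(j < N) f j * (g ^+ j) n.
Proof.
move=> g0 ltnN; rewrite /fps_comp (big_ord_widen N (fun j => f j * fps_exp g j n)) //.
rewrite big_mkcond; apply: eq_bigr => j _; rewrite -fps_expE; case: ltnP => // ltnj.
by rewrite fps_exp_small // mulr0.
Qed.

Lemma agree_comp n p q f g :
  g 0 = 0 -> agree n p f -> agree n q g -> agree n (p \Po q) (fps_comp f g).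
Proof.
move=> g0 pf qg i lein; rewrite coef_comp_poly.
(* The degree of p is unrelated to i, so both sums are extended to a common bound. Beyond i the
   powers of g vanish at t^i; beyond the degree of p, the f j with j <= i are zero coefficients of
   p. *)
rewrite (fps_comp_widen f (N := maxn i.+1 (size p))) ?leq_max ?leqnn //.
rewrite (big_ord_widen (maxn i.+1 (size p)) (fun j => p`_j * (q ^+ j)`_i));
  last by rewrite leq_maxr.
rewrite big_mkcond; apply: eq_bigr => -[j /= _] _.
rewrite -fps_expE (agreeX j qg) //; case: ltnP => [_|lepj].
  have [leji|ltij] := leqP j i; first by rewrite pf // (leq_trans leji).
  by rewrite fps_exp_small // !mulr0.
have [leji|ltij] := leqP j i; last by rewrite fps_exp_small // mulr0.
by rewrite -pf ?(leq_trans leji) // nth_default // mul0r.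
Qed.

Lemma fps_compM f g h : h 0 = 0 -> fps_comp (f * g) h = fps_comp f h * fps_comp g h.
Proof.
move=> h0; apply/funext => n.
have [[af ag] ah] :=
  (agree_trunc (n := n) f, agree_trunc (n := n) g, agree_trunc (n := n) h).
rewrite -(agree_comp h0 (agreeM af ag) ah (leqnn n)) comp_polyM.
exact: (agreeM (agree_comp h0 af ah) (agree_comp h0 ag ah) (leqnn n)).
Qed.

Lemma fps_comp1 g : fps_comp 1 g = 1.
Proof.
apply/funext => n; rewrite /fps_comp big_ord_recl /= mul1r big1 ?addr0 // => i _.
by rewrite mul0r.
Qed.

Lemma fps_compB f g h : fps_comp (f - g) h = fps_comp f h - fps_comp g h.
Proof.
apply/funext => n; rewrite -[RHS]/(fps_comp f h n - fps_comp g h n).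
by rewrite -sumrB; apply: eq_bigr => i _; rewrite mulrBl.
Qed.

Lemma fps_comp_var g : g 0 = 0 -> fps_comp fps_var g = g.
Proof.
move=> g0; apply/funext => n; rewrite (@fps_comp_widen _ _ _ n.+2) //.
rewrite big_ord_recl mul0r add0r big_ord_recl mul1r expr1 big1 ?addr0 // => i _.
by rewrite mul0r.
Qed.

Lemma fps_compX f h m : h 0 = 0 -> fps_comp (f ^+ m) h = fps_comp f h ^+ m.
Proof.
move=> h0; elim: m => [|m IH]; first by rewrite !expr0 fps_comp1.
by rewrite !exprS fps_compM // IH.
Qed.

(** Moves the sign from the ring of series to the coefficient ring. *)
Lemma fps_oppX f m n : ((- f) ^+ m) n = (-1) ^+ m * (f ^+ m) n.
Proof.
rewrite [in LHS]exprNn -(signr_odd (fps A) m) -(signr_odd A m).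
by case: (odd m); rewrite ?mul1r // expr1 !mulN1r.
Qed.

Lemma fps_mul_tdivE f : f 0 = 0 -> f 1 = 1 -> f * fps_tdiv f = fps_var.
Proof. by move=> f0 f1; apply/funext => n; apply: fps_mul_tdiv. Qed.

End Series.

Arguments fps_var {A}.

(** * Stirling numbers, the logarithm and binomial series *)

Lemma stirling1_rec n l :
  stirling1 n.+1 l = (if l is l'.+1 then stirling1 n l' else 0) - n%:R * stirling1 n l.
Proof.
rewrite /stirling1 big_ord_recr /= mulrBr coefB coefMX coefMC [_ * n%:R]mulrC.
by case: l.
Qed.

Section Logarithm.
Variable A : comUnitRingType.
Hypothesis natU : forall n, (n.+1%:R : A) \is a GRing.unit.
Local Notation L := (fps_log1p A).

Lemma factU n : (n`!%:R : A) \is a GRing.unit.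
Proof. by rewrite -(prednK (fact_gt0 n)). Qed.

Lemma log1p_mulrn n : L n.+1 *+ n.+1 = (-1) ^+ n.
Proof. by rewrite -[LHS]mulr_natr /= mulrVK ?natU. Qed.

(* The coefficient form of (1 + t) (L^(m+1))' = (m + 1) L^m. *)
Lemma log1p_exp_rec m n :
  n.+1%:R * (L ^+ m.+1) n.+1 + n%:R * (L ^+ m.+1) n = m.+1%:R * (L ^+ m) n.
Proof.
set p := fps_trunc n.+2 L.
have ap : agree n.+1 p L by apply: agree_trunc.
(* This is (1 + t) L' = 1: the coefficients (-1)^i of L' cancel in consecutive pairs. The truncation
   keeps degree n + 1 because differentiation loses one degree. *)
have dp : agree n ((1 + 'X) * p^`()) (fps_one A).
  move=> i lein; rewrite mulrDl mul1r coefD coefXM !coef_deriv /fps_one.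
  rewrite ap ?ltnS // log1p_mulrn.
  case: i lein => [|i] lein; first by rewrite addr0.
  by rewrite ap ?(leq_trans lein) // log1p_mulrn exprS mulN1r addNr.
have aX : agree n (p ^+ m) (L ^+ m).
  by move=> i lein; rewrite (agreeX m ap) ?fps_expE // (leq_trans lein).
have := agreeM dp aX (leqnn n); rewrite fps_mul1 => <-.
rewrite [in RHS]mulr_natl -coefMn -!fps_expE -!(agreeX m.+1 ap) ?leqnSn //.
have -> : ((1 + 'X) * p^`() * p ^+ m) *+ m.+1 = (1 + 'X) * (p ^+ m.+1)^`().
  by rewrite deriv_exp /= -mulrnAr -mulrnAr mulrA.
have -> (q : {poly A}) : ((1 + 'X) * q^`())`_n = q`_n.+1 *+ n.+1 + q`_n *+ n.
  rewrite mulrDl mul1r coefD coefXM !coef_deriv.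
  by case: (n) => [|n']; rewrite ?mulr0n.
by rewrite ![_%:R * _]mulr_natl.
Qed.

(** By induction on n: [stirling1_rec] and [log1p_exp_rec] give both sides the same recurrence. *)
Lemma stirling1_log1p n m : (stirling1 n m)%:~R = n`!%:R * ((L ^+ m) n / m`!%:R).
Proof.
elim: n m => [|n IH] m.
  rewrite /stirling1 big_ord0 coef1 fact0 mul1r -fps_expE.
  case: m => [|m]; first by rewrite /fps_exp /= /fps_one /= fact0 invr1 mulr1.
  by rewrite fps_exp_small // mul0r.
rewrite stirling1_rec rmorphB rmorphM /= IH.
case: m => [|m].
  have L0E j : (L ^+ 0) j = (j == 0)%:R by [].
  by rewrite !L0E; case: n {IH} => [|n] /=; rewrite !(mul0r, mulr0) subr0.
rewrite /= IH [n.+1`!]factS [in RHS]natrM.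
(* Produces the factor m + 1 in front of L^m that [log1p_exp_rec] needs. *)
have -> : m`!%:R^-1 = m.+1%:R / m.+1`!%:R :> A.
  by rewrite factS natrM invrM ?factU ?natU // mulrCA mulrV ?natU ?mulr1.
rewrite [(L ^+ m) n * _]mulrA [_ * m.+1%:R]mulrC -log1p_exp_rec.
set a := (L ^+ _) _; set b := (L ^+ _) _; set c := _^-1.
rewrite rmorph_nat.
ring.
Qed.

Lemma gbinom_stirling1 (a : A) n :
  gbinom a n = (\sum_(m < n.+1) (stirling1 n m)%:~R * a ^+ m) / n`!%:R.
Proof.
rewrite /gbinom; congr (_ / _).
pose p : {poly int} := \prod_(i < n) ('X - (i%:R)%:P).
have sp : size p = n.+1 by rewrite size_prod_XsubC /index_enum -enumT size_enum_ord.
transitivity (map_poly (intr : int -> A) p).[a].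
  rewrite /p rmorph_prod horner_prod; apply: eq_bigr => i _.
  by rewrite rmorphB /= map_polyX map_polyC /= hornerXsubC rmorph_nat.
rewrite (@horner_coef_wide _ n.+1) ?(leq_trans (size_poly _ _)) ?sp //.
by apply: eq_bigr => i _; rewrite coef_map.
Qed.

(** On both sides the coefficient of t^n is the sum over m of S_1(n,m) (-a)^m / n!: on the left by
    expanding L^m/m!, on the right by expanding the falling factorial of -a. *)
Lemma expt_comp_log1p_opp (a : A) : fps_comp (fps_expt a) (- L) = fps_binom (- a).
Proof.
apply/funext => n; rewrite /fps_binom gbinom_stirling1 mulr_suml.
apply: eq_bigr => m _; rewrite stirling1_log1p /fps_expt fps_expE.
rewrite fps_oppX [in RHS]exprNn; set b := m`!%:R^-1; set c := (L ^+ m) n.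
by apply: (mulIr (factU n)); rewrite mulrVK ?factU //; ring.
Qed.

Lemma fps_exptD (a b : A) : fps_expt (a + b) = fps_expt a * fps_expt b.
Proof.
apply/funext => n; rewrite /fps_expt addrC exprDn mulr_suml.
apply: eq_bigr => i _; rewrite -mulr_natr.
have lein : (i <= n)%N by rewrite -ltnS.
have -> : 'C(n, i)%:R = n`!%:R / i`!%:R / (n - i)`!%:R :> A.
  apply: (mulIr (factU (n - i))); rewrite mulrVK ?factU //.
  apply: (mulIr (factU i)); rewrite mulrVK ?factU //.
  by rewrite -!natrM -mulnA [((_ - _)`! * _)%N]mulnC bin_fact.
apply: (mulIr (factU n)); rewrite mulrVK ?factU //.
ring.
Qed.

(** The Vandermonde identity, obtained from the addition law of e^(at) by substituting -L for t. *)
Lemma fps_binomD (a b : A) : fps_binom (a + b) = fps_binom a * fps_binom b.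
Proof.
have L0 : (- L) 0 = 0 by apply: oppr0.
by rewrite -[a]opprK -[b]opprK -opprD -!expt_comp_log1p_opp fps_exptD fps_compM.
Qed.

Lemma fps_binom0 : fps_binom 0 = 1 :> fps A.
Proof.
apply/funext => -[|n]; first by rewrite /fps_binom /gbinom big_ord0 fact0 divr1.
by rewrite /fps_binom /gbinom big_ord_recl subrr !mul0r.
Qed.

Lemma fps_binom1 : fps_binom 1 = 1 + fps_var :> fps A.
Proof.
apply/funext => -[|[|n]]; rewrite /fps_binom /gbinom.
- by rewrite big_ord0 fact0 divr1 -[RHS]/(1 + 0) addr0.
- by rewrite big_ord_recl big_ord0 subr0 mulr1 divr1 -[RHS]/(0 + 1) add0r.
by rewrite !big_ord_recl /= subrr mul0r mulr0 mul0r -[RHS]/(0 + 0) addr0.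
Qed.

Lemma fps_binomMn (a : A) s : fps_binom (a *+ s) = fps_binom a ^+ s.
Proof.
elim: s => [|s IH]; first by rewrite mulr0n fps_binom0.
by rewrite mulrS exprS fps_binomD IH.
Qed.

(** Here D = -L/(e^(-L) - 1) = L(1+t)/t, because e^(-L) - 1 = V - 1 with V = 1/(1+t); the factors T
    = t/L and V cancel it. *)
Lemma tdiv_expm1_comp_log1p :
  fps_comp (fps_tdiv (fps_expm1 A)) (- L) * fps_tdiv L * fps_binom (- 1) = 1.
Proof.
set D := fps_comp _ _; set T := fps_tdiv L; set V := fps_binom _.
have L0 : (- L) 0 = 0 by apply: oppr0.
have LT : L * T = fps_var by rewrite fps_mul_tdivE //; apply: divr1.
have VX : V * (1 + fps_var) = 1 by rewrite -fps_binom1 -fps_binomD addNr fps_binom0.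
have VD : (V - 1) * D = - L.
  rewrite -(fps_comp_var L0) -(@fps_mul_tdivE _ (fps_expm1 A)) //; last first.
    by rewrite /fps_expm1 invr1.
  rewrite fps_compM //; congr (_ * _).
  have -> : fps_expm1 A = fps_expt 1 - 1.
    apply/funext => -[|n]; rewrite -[RHS]/(fps_expt 1 _ - fps_one A _).
      by rewrite /fps_expt expr0 fact0 divr1 subrr.
    by rewrite /fps_expt expr1n mul1r subr0.
  by rewrite fps_compB fps_comp1 expt_comp_log1p_opp.
(* Division by t is avoided by proving the identity times t; writing 1 as V(1+t) turns V - 1 into
   -tV. *)
apply: (@fps_var_inj A).
transitivity (- ((V - 1) * D * T)); last by rewrite VD mulNr opprK LT mulr1.
by rewrite -{1}VX; ring.
Qed.

(** The s-th power of [tdiv_expm1_comp_log1p] cancels all but the image (1+t)^(-a) of e^(at). *)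
Lemma bernoulli_comp_log1p s (a : A) :
  fps_comp (fps_tdiv (fps_expm1 A) ^+ s * fps_expt a) (- L)
    * (fps_tdiv L ^+ s * fps_binom (- s%:R)) = fps_binom (- a).
Proof.
have L0 : (- L) 0 = 0 by apply: oppr0.
rewrite fps_compM // fps_compX // expt_comp_log1p_opp -mulNrn fps_binomMn.
by rewrite mulrAC mulrA -!exprMn tdiv_expm1_comp_log1p // expr1n mul1r.
Qed.

End Logarithm.

(** * Ring morphisms acting on coefficients *)

Section Naturality.
Variables (A B : comUnitRingType) (phi : {rmorphism A -> B}).
Implicit Types (f g : fps A).

Definition fps_map f : fps B := fun n => phi (f n).

Lemma fps_mapM f g : fps_map (fps_mul f g) = fps_mul (fps_map f) (fps_map g).
Proof.
apply/funext => n; rewrite /fps_map /fps_mul rmorph_sum.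
by apply: eq_bigr => i _; rewrite rmorphM.
Qed.

Lemma fps_map_one : fps_map (fps_one A) = fps_one B.
Proof. by apply/funext => n; rewrite /fps_map rmorph_nat. Qed.

Lemma fps_map_exp f m : fps_map (fps_exp f m) = fps_exp (fps_map f) m.
Proof.
elim: m => [|m IH]; first exact: fps_map_one.
by rewrite /fps_exp !iterS fps_mapM -/(fps_exp f m) IH.
Qed.

Lemma fps_map_comp f g :
  fps_map (fps_comp f g) = fps_comp (fps_map f) (fps_map g).
Proof.
apply/funext => n; rewrite /fps_map /fps_comp rmorph_sum.
by apply: eq_bigr => i _; rewrite rmorphM -fps_map_exp.
Qed.

Lemma fps_map_tdiv f : fps_map (fps_tdiv f) = fps_tdiv (fps_map f).
Proof.
rewrite /fps_tdiv /fps_inv fps_map_comp; congr fps_comp; apply/funext => n.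
  by rewrite /fps_map rmorph1.
by rewrite /fps_map rmorphB rmorph_nat.
Qed.

Hypothesis natU : forall n, (n.+1%:R : A) \is a GRing.unit.

Lemma fps_map_binom a : fps_map (fps_binom a) = fps_binom (phi a).
Proof.
apply/funext => n; rewrite /fps_map /fps_binom /gbinom rmorphM rmorphV ?factU //.
rewrite rmorph_prod rmorph_nat; congr (_ / _).
by apply: eq_bigr => i _; rewrite rmorphB rmorph_nat.
Qed.

Lemma fps_map_log1p : fps_map (fps_log1p A) = fps_log1p B.
Proof.
apply/funext => -[|n]; rewrite /fps_map /=; first exact: rmorph0.
by rewrite rmorphM rmorphXn rmorphN1 rmorphV ?natU // rmorph_nat.
Qed.

Lemma fps_map_Lif k : fps_map (Lif A k) = Lif B k.
Proof.
apply/funext => n; rewrite /fps_map /Lif.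
by rewrite rmorphV ?unitrM ?factU ?unitrXz // rmorphM rmorphXz // !rmorph_nat.
Qed.

Lemma fps_map_half_binom a : fps_map (half_binom a) = half_binom (phi a).
Proof.
apply/funext => -[|n]; rewrite /fps_map /half_binom; first exact: rmorph0.
rewrite rmorphM rmorphV // rmorph_nat; congr (_ * _).
exact: (congr1 (fun f : fps B => f n.+1) (fps_map_binom a)).
Qed.

End Naturality.

Lemma poly_natU (R : realType) n : (n.+1%:R : {poly R[i]}) \is a GRing.unit.
Proof.
by rewrite -(rmorph_nat (@polyC R[i])) rmorph_unit // unitfE pnatr_eq0.
Qed.

(** * Specialising x to a constant *)

Section Evaluation.
Variable R : realType.
Local Notation P := {poly R[i]}.
Variable c : R[i].

Local Notation ev := (fps_map (comp_poly c%:P : {rmorphism P -> P})).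
Let natU := @poly_natU R.

Lemma ev_binom_oppX : ev (fps_binom (- 'X)) = fps_binom (- c%:P).
Proof. by rewrite fps_map_binom //= rmorphN /= comp_polyX. Qed.

(** Evaluation is read as substitution of a constant polynomial, so that specialised series stay in
    the same ring as those involving x. *)
Lemma egf_coef_eval (f : fps P) n : ((egf_coef f n).[c])%:P = egf_coef (ev f) n.
Proof. by rewrite -comp_polyCr /egf_coef rmorphM rmorph_nat. Qed.

(** The factor G(t), free of x. *)
Definition CP_const (k : int) (lambda mu : R[i]) : fps P :=
  peters_factor lambda mu * fps_comp (Lif P k) (fps_log1p P).

Lemma ev_CP_const k lambda mu : ev (CP_const k lambda mu) = CP_const k lambda mu.
Proof.
rewrite /CP_const fps_mapM; congr fps_mul; last first.
  by rewrite fps_map_comp fps_map_Lif // fps_map_log1p.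
rewrite /peters_factor; apply/funext => n.
rewrite /fps_map /fps_scale rmorphM /= comp_polyC; congr (_ * _).
by rewrite -/(ev _ n) fps_map_comp fps_map_binom // fps_map_half_binom //= !comp_polyC.
Qed.

Lemma CP_eval k lambda mu n :
  ((CP k lambda mu n).[c])%:P = egf_coef (CP_const k lambda mu * fps_binom (- c%:P)) n.
Proof. by rewrite /CP egf_coef_eval fps_mapM ev_binom_oppX ev_CP_const. Qed.

End Evaluation.

Lemma cauchy_numE (R : realType) s n :
  (cauchy_num R s n)%:P = egf_coef (fps_tdiv (fps_log1p {poly R[i]}) ^+ s) n.
Proof.
have natU := @poly_natU R.
rewrite /cauchy_num /cauchy_poly egf_coef_eval fps_mapM ev_binom_oppX.
rewrite fps_map_exp fps_map_tdiv fps_map_log1p // fps_expE.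
by rewrite polyC0 oppr0 fps_binom0 //; congr (egf_coef _ n); apply: mulr1.
Qed.

(** * Comparison of coefficients *)

Local Open Scope complex_scope.

Theorem theorem10 (R : realType) (k : int) (lambda mu : R[i]) (s n : nat) :
  CP k lambda mu n =
  \sum_(0 <= m < n.+1)
    ((-1) ^+ m *
      (\sum_(0 <= l < (n - m).+1) \sum_(0 <= i < l.+1)
         'C(n, l)%:R * 'C(l, i)%:R * (stirling1 (n - l) m)%:~R *
         cauchy_num R s i * (CP k lambda mu (l - i)).[s%:R]))
    *: bernoulli_poly R s m.
Proof.
have natU := @poly_natU R.
pose L := fps_log1p {poly R[i]}; pose T := fps_tdiv L ^+ s.
pose H := CP_const k lambda mu * fps_binom (- s%:R).
pose b := fps_tdiv (fps_expm1 {poly R[i]}) ^+ s * fps_expt 'X.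
have L0 : (- L) 0 = 0 by apply: oppr0.
have -> : CP k lambda mu n = n`!%:R * ((fps_comp b (- L) * (T * H)) n).
  suff -> : fps_comp b (- L) * (T * H) = CP_const k lambda mu * fps_binom (- 'X) by [].
  by rewrite -(bernoulli_comp_log1p natU s) -/b -/L -/T /H; ring.
(* In [F m l], the product T H contributes degree l and L^m contributes degree n - l. *)
pose F m l := (-1) ^+ m * (n`!%:R * ((L ^+ m) (n - l)%N * (T * H) l)) * b m.
transitivity (\sum_(m < n.+1) \sum_(l < n.+1) F m l).
  rewrite [fps_comp _ _ * _]mulrC exchange_big mulr_sumr; apply: eq_bigr => l _.
  (* A range for m independent of l makes the two sums interchangeable. *)
  rewrite (@fps_comp_widen _ _ _ _ n.+1) ?ltnS ?leq_subr // !mulr_sumr.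
  apply: eq_bigr => m _; rewrite fps_oppX /F; ring.
rewrite big_mkord; apply: eq_bigr => -[m /= lemn] _.
have -> : bernoulli_poly R s m = m`!%:R * b m by rewrite /b -fps_expE.
rewrite -mul_polyC mulrA.
rewrite rmorphM rmorphXn rmorphN1 rmorph_sum /= big_mkord.
(* For l > n - m the term is zero, since L^m has no term of degree n - l < m. *)
rewrite (bigID (fun l : 'I_n.+1 => (l < (n - m).+1)%N)) /= [X in _ + X]big1 ?addr0;
  last first.
  move=> l; rewrite -leqNgt => lel; rewrite /F -fps_expE fps_exp_small //; first last.
    by have := ltn_ord l; move: lel lemn; lia.
  by rewrite !(mul0r, mulr0).
rewrite -(big_ord_widen n.+1 (F m)) ?ltnS ?leq_subr //.
clearbody b; rewrite [in RHS]mulr_sumr !mulr_suml; apply: eq_bigr => -[l /= lel] _.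
rewrite big_mkord rmorph_sum /F -[(T * H) l]/(fps_mul T H l) /fps_mul.
rewrite !(mulr_sumr, mulr_suml); apply: eq_bigr => -[i /= lei] _.
rewrite !rmorphM !rmorph_nat rmorph_int /= cauchy_numE CP_eval /egf_coef.
rewrite (stirling1_log1p natU) -/L -/T polyC_natr -/H.
have lln : (l <= n)%N by rewrite (leq_trans (n := (n - m)%N)) ?leq_subr.
(* The three factorials are the normalisations of the Stirling, Cauchy and [CP] coefficients. *)
have -> : n`!%:R = 'C(n, l)%:R * 'C(l, i)%:R * (n - l)`!%:R * i`!%:R * (l - i)`!%:R
    :> {poly R[i]}.
  rewrite -!natrM; congr (_%:R).
  rewrite -(bin_fact lln) -(bin_fact (lei : i <= l)%N); lia.
(* Inserts 1/m! and m!, which on the right come from L^m/m! and from the Bernoulli polynomial. *)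
rewrite -[in LHS](mulrVK (factU natU m) ((L ^+ m) (n - l)%N)).
ring.
Qed.
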